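(* Let $p,q$ be integers, let $r,s$ be nonzero integers, let $m\ge 1$ be an integer and $l\in\{0,1,\dots,m-1\}$. Then the ordinary generating function $$GHml(p,q;r,s;m,l;x):=\sum_{n=0}^{\infty}H(p,q;r,s;mn+l)\,x^n$$ is given, as a formal power series in $x$, by $$GHml(p,q;r,s;m,l;x)=\frac{H(p,q;r,s;l)-\bigl(H(p,q;r,s;l)\,SUM(r,s;m)-H(p,q;r,s;m+l)\bigr)x}{1-SUM(r,s;m)\,x+(-s)^m\,x^2},$$ where $$SUM(r,s;m)=r^m\sum_{k=0}^{\lfloor m/2\rfloor}T(m,k)\,\left(\frac{s}{r^2}\right)^k .$$
   Context: For given $p,q,r,s$, the (Horadam) sequence $H(p,q;r,s;n)$, $n\ge 0$, is defined by $H(p,q;r,s;0)=p$, $H(p,q;r,s;1)=q$ and $H(p,q;r,s;n)=r\,H(p,q;r,s;n-1)+s\,H(p,q;r,s;n-2)$ for $n\ge 2$. $T(n,k)$ is the irregular triangle OEIS A034807: $T(0,0)=2$ and $T(n,k)=\frac{n\,(n-1-k)!}{k!\,(n-2k)!}$ for $n\ge 1$ and $0\le k\le\lfloor n/2\rfloor$. *)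

(* Defs.v *)
From HB Require Import structures.
From mathcomp Require Import all_boot all_order all_algebra.
From mathcomp Require Import boolp.

Set Implicit Arguments.
Unset Strict Implicit.
Unset Printing Implicit Defensive.

Import GRing.Theory.
Local Open Scope ring_scope.

(* Formal power series in one variable.  The record (rather than a bare       *)
(* function type) keeps the Cauchy product from being confused with the       *)
(* pointwise one.                                                             *)
Record fps (R : Type) := FPS { fcoef : nat -> R }.

HB.instance Definition _ (R : Type) := gen_eqMixin (fps R).
HB.instance Definition _ (R : Type) := gen_choiceMixin (fps R).

Lemma fpsP (R : Type) (f g : fps R) : fcoef f =1 fcoef g <-> f = g.
Proof.
by split=> [|-> //]; case: f g => [f] [g] /= fg; congr FPS; apply/funext.
Qed.

Section FpsRing.
Variable R : comUnitRingType.
Implicit Types f g h : fps R.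

Definition fpsC (c : R) : fps R := FPS (fun n => if n == 0%N then c else 0).
Definition fpsX : fps R := FPS (fun n => (n == 1%N)%:R).

Definition fps_add f g : fps R := FPS (fun n => fcoef f n + fcoef g n).
Definition fps_opp f : fps R := FPS (fun n => - fcoef f n).
Definition fps_mul f g : fps R :=
  FPS (fun n => \sum_(i < n.+1) fcoef f i * fcoef g (n - i)).

Fact fps_addA : associative fps_add.
Proof. by move=> f g h; apply/fpsP => n /=; rewrite addrA. Qed.
Fact fps_addC : commutative fps_add.
Proof. by move=> f g; apply/fpsP => n /=; rewrite addrC. Qed.
Fact fps_add0 : left_id (fpsC 0) fps_add.
Proof. by move=> f; apply/fpsP => n /=; rewrite if_same add0r. Qed.
Fact fps_addN : left_inverse (fpsC 0) fps_opp fps_add.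
Proof. by move=> f; apply/fpsP => n /=; rewrite if_same addNr. Qed.

HB.instance Definition _ :=
  GRing.isZmodule.Build (fps R) fps_addA fps_addC fps_add0 fps_addN.

Definition fps_trunc (N : nat) f : {poly R} := \poly_(i < N) fcoef f i.

Lemma coef_fps_mul N f g n : (n < N)%N ->
  fcoef (fps_mul f g) n = (fps_trunc N f * fps_trunc N g)`_n.
Proof.
move=> ltnN; rewrite coefM; apply: eq_bigr => i _.
have leiN : (i < N)%N by apply: leq_ltn_trans ltnN; rewrite -ltnS.
by rewrite !coef_poly leiN (leq_ltn_trans (leq_subr _ _) ltnN).
Qed.

Fact fps_mulA : associative fps_mul.
Proof.
move=> f g h; apply/fpsP => n.
rewrite !(@coef_fps_mul n.+1) //.
set p := fps_trunc _ f; set r := fps_trunc _ h.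
transitivity (p * (fps_trunc n.+1 g * r))`_n.
  rewrite !coefM; apply: eq_bigr => i _; congr (_ * _).
  by rewrite coef_poly ltnS leq_subr (@coef_fps_mul n.+1) // ltnS leq_subr.
rewrite mulrA !coefM; apply: eq_bigr => i _; congr (_ * _).
by rewrite coef_poly ltn_ord (@coef_fps_mul n.+1).
Qed.

Fact fps_mulC : commutative fps_mul.
Proof. by move=> f g; apply/fpsP => n; rewrite !(@coef_fps_mul n.+1) // mulrC. Qed.

Fact fps_mul1 : left_id (fpsC 1) fps_mul.
Proof.
move=> f; apply/fpsP => n /=; rewrite big_ord_recl /= mul1r subn0.
by rewrite big1 ?addr0 // => i _; rewrite mul0r.
Qed.

Fact fps_mulDl : left_distributive fps_mul fps_add.
Proof.
move=> f g h; apply/fpsP => n /=; rewrite -big_split /=.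
by apply: eq_bigr => i _; rewrite mulrDl.
Qed.

Fact fps_one_neq0 : fpsC 1 != 0.
Proof.
apply/eqP => /fpsP/(_ 0%N)/= /eqP; exact/negP/oner_neq0.
Qed.

HB.instance Definition _ :=
  GRing.Zmodule_isComNzRing.Build (fps R)
    fps_mulA fps_mulC fps_mul1 fps_mulDl fps_one_neq0.

(* fps_inv_seq f n lists the first n coefficients of 1 / f. *)
Fixpoint fps_inv_seq f n : seq R :=
  if n is n'.+1 then
    let s := fps_inv_seq f n' in
    rcons s ((fcoef f 0)^-1 *
      ((n' == 0%N)%:R - \sum_(i < n') fcoef f (n' - i) * s`_i))
  else [::].

Definition fps_unit : pred (fps R) := fun f => fcoef f 0 \is a GRing.unit.
(* The value at non-units is the usual junk value x^-1 = x. *)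
Definition fps_inv f : fps R :=
  if fps_unit f then FPS (fun n => (fps_inv_seq f n.+1)`_n) else f.

Lemma size_fps_inv_seq f n : size (fps_inv_seq f n) = n.
Proof. by elim: n => //= n IHn; rewrite size_rcons IHn. Qed.

Lemma nth_fps_inv_seq f n i : (i < n)%N ->
  (fps_inv_seq f n)`_i = (fps_inv_seq f i.+1)`_i.
Proof.
elim: n => // n IHn; rewrite ltnS leq_eqVlt => /orP[/eqP-> //|ltin].
by rewrite [LHS]/= nth_rcons size_fps_inv_seq ltin IHn.
Qed.

Fact fps_mulV : {in fps_unit, left_inverse 1 fps_inv *%R}.
Proof.
move=> f uf; rewrite [_ * _]fps_mulC /fps_inv ifT //.
have uf0 : fcoef f 0 \is a GRing.unit := uf.
apply/fpsP => n; rewrite [LHS]/= (reindex_inj rev_ord_inj) /=.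
rewrite big_ord_recr /= subSS subnn.
rewrite nth_rcons size_fps_inv_seq subn0 ltnn eqxx mulrA divrr // mul1r.
rewrite (eq_bigr (fun i : 'I_n => fcoef f (n - i) * (fps_inv_seq f n)`_i)).
  by rewrite addrC subrK; case: eqP.
move=> i _; rewrite subSS subKn 1?ltnW //.
by rewrite -[rcons _ _]/(fps_inv_seq f i.+1) -(@nth_fps_inv_seq f n).
Qed.

Fact fps_unitPl f g : g * f = 1 -> fps_unit f.
Proof.
move=> /fpsP/(_ 0%N); rewrite /= big_ord_recl big_ord0 addr0 /= => gf1.
by apply/unitrPr; exists (fcoef g 0); rewrite mulrC.
Qed.

Fact fps_inv_out : {in [predC fps_unit], fps_inv =1 id}.
Proof. by move=> f nuf; rewrite /fps_inv ifN. Qed.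

HB.instance Definition _ :=
  GRing.ComNzRing_hasMulInverse.Build (fps R) fps_mulV fps_unitPl fps_inv_out.

End FpsRing.

Arguments fpsX {R}.

Fixpoint horadam (p q r s : int) (n : nat) : int :=
  match n with
  | 0 => p
  | 1 => q
  | (n'.+1 as n1).+1 => r * horadam p q r s n1 + s * horadam p q r s n'
  end.

(* OEIS A034807; entries outside the triangle (k > n / 2) are set to 0. *)
Definition lucasT (n k : nat) : rat :=
  if (k <= n./2)%N then
    if n == 0%N then 2
    else (n * (n - 1 - k)`!)%N%:R / (k`! * (n - 2 * k)`!)%N%:R
  else 0.

Definition SUM (r s : int) (m : nat) : rat :=
  r%:~R ^+ m * \sum_(0 <= k < (m./2).+1) lucasT m k * (s%:~R / r%:~R ^+ 2) ^+ k.

Definition GHml (p q r s : int) (m l : nat) : fps rat :=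
  FPS (fun n => (horadam p q r s (m * n + l)%N)%:~R).

(* Main.v *)
(** The triangle rule T(n+2, k+1) = T(n+1, k+1) + T(n, k) shows that
    V_m = [SUM r s m] is the Lucas sequence V_0 = 2, V_1 = r,
    V_(m+2) = r V_(m+1) + s V_m.  Every solution of the recurrence then
    satisfies H(n+2m) = V_m H(n+m) - (-s)^m H(n), by two-step induction on m,
    so multiplying the series by its denominator leaves only the coefficients
    of 1 and x. *)
Require Import Defs.
From mathcomp Require Import all_boot all_order all_algebra.
From mathcomp Require Import zify ring.

Import GRing.Theory Num.Theory.
Local Open Scope ring_scope.

Lemma fcoefD (R : comUnitRingType) (f g : fps R) n :
  fcoef (f + g) n = fcoef f n + fcoef g n.
Proof. by []. Qed.

Lemma fcoefB (R : comUnitRingType) (f g : fps R) n :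
  fcoef (f - g) n = fcoef f n - fcoef g n.
Proof. by []. Qed.

Lemma fcoefC (R : comUnitRingType) (c : R) n :
  fcoef (fpsC c) n = if n == 0%N then c else 0.
Proof. by []. Qed.

Lemma fcoefCM (R : comUnitRingType) (c : R) (f : fps R) n :
  fcoef (fpsC c * f) n = c * fcoef f n.
Proof.
rewrite [LHS]/= big_ord_recl /= subn0 big1 ?addr0 // => i _.
by rewrite mul0r.
Qed.

Lemma fcoefXM (R : comUnitRingType) (f : fps R) n :
  fcoef (fpsX * f) n = if n is n'.+1 then fcoef f n' else 0.
Proof.
case: n => [|n]; rewrite [LHS]/= big_ord_recl /= mul0r add0r ?big_ord0 //.
rewrite big_ord_recl /= mul1r subSS subn0 big1 ?addr0 // => i _.
by rewrite mul0r.
Qed.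

Lemma fcoefX (R : comUnitRingType) n : fcoef (@fpsX R) n = (n == 1%N)%:R.
Proof. by []. Qed.

(** The denominator has constant coefficient 1, hence is a unit, so the division can be cleared and
    coefficients compared. *)
Lemma fps_eq_div (R : comUnitRingType) (f : fps R) (a b c d : R) :
  fcoef f 0 = a -> fcoef f 1 = c * a - b ->
  (forall n, fcoef f n.+2 = c * fcoef f n.+1 - d * fcoef f n) ->
  f = (fpsC a - fpsC b * fpsX) / (1 - fpsC c * fpsX + fpsC d * fpsX ^+ 2).
Proof.
move=> f0 f1 fS; set D := 1 - _ + _.
have D0 : fcoef D 0 = 1.
  by rewrite fcoefD fcoefB !fcoefCM expr2 fcoefXM fcoefX !mulr0 subr0 addr0.
have uD : D \is a GRing.unit.
  by rewrite unfold_in -[X in is_true X]/(fcoef D 0 \is a GRing.unit) D0 unitr1.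
apply: (canRL (mulrK uD)).
(* In this form every power of [fpsX] acts on [f] as an index shift. *)
have -> : f * D = f - fpsC c * (fpsX * f) + fpsC d * (fpsX * (fpsX * f)).
  by rewrite /D; ring.
apply/fpsP => -[|[|n]]; rewrite fcoefD !fcoefB !fcoefCM !fcoefXM fcoefC fcoefX /=.
- by rewrite f0; ring.
- by rewrite f1 f0; ring.
- by rewrite fS; ring.
Qed.

Lemma lucasT0 n : lucasT n.+1 0 = 1.
Proof.
rewrite /lucasT /= subn1 subn0 fact0 mul1n muln0 subn0 -factS divff //.
by rewrite pnatr_eq0 -lt0n fact_gt0.
Qed.

Lemma lucasT_rec n k :
  lucasT n.+2 k.+1 = lucasT n.+1 k.+1 + lucasT n k.
Proof.
have fact_neq0 i : i`!%:R != 0 :> rat by rewrite pnatr_eq0 -lt0n fact_gt0.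
(* For [n < 2 * k] all three entries lie outside the triangle. *)
have [lt_n2k|] := ltnP n (2 * k).
  by rewrite /lucasT !ifF ?addr0 //; lia.
rewrite leq_eqVlt => /orP[/eqP<-|lt2kn].
  (* On the edge [n = 2 * k] the middle entry vanishes and the other two equal 2; [k = 0] is
     separate because T(0,0) = 2 is a convention, not a value of the formula. *)
  case: k => [|k]; first by [].
  rewrite /lucasT ifT; last by lia.
  rewrite [in X in _ = X + _]ifF; last by lia.
  rewrite ifT; last by lia.
  rewrite add0r.
  have -> : ((2 * k.+1).+2 - 1 - k.+2 = k.+1)%N by lia.
  have -> : ((2 * k.+1) - 1 - k.+1 = k)%N by lia.
  have -> : ((2 * k.+1).+2 - 2 * k.+2 = 0)%N by lia.
  rewrite subnn fact0 !muln1 !factS !natrM.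
  have := fact_neq0 k; move: (k`!%:R) => K K0.
  have k1 : k.+1%:R != 0 :> rat by rewrite pnatr_eq0.
  have k2 : k.+2%:R != 0 :> rat by rewrite pnatr_eq0.
  have -> : (2 * k.+1).+2%:R = 2 * k.+2%:R :> rat by rewrite -natrM; congr _%:R; lia.
  by rewrite -!natr1 in k1 k2 *; field; rewrite K0 k1 k2.
(* This parametrization turns all truncated subtractions into sums, leaving an identity of fractions
   in [k], [j] and their factorials. *)
have [j nE] : exists j, n = (2 * k + j).+1.
  by exists (n - 2 * k).-1; lia.
rewrite nE /lucasT !ifT; [|by lia..].
have -> : ((2 * k + j).+3 - 1 - k.+1 = (k + j).+1)%N by lia.
have -> : ((2 * k + j).+2 - 1 - k.+1 = k + j)%N by lia.
have -> : ((2 * k + j).+1 - 1 - k = k + j)%N by lia.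
have -> : ((2 * k + j).+3 - 2 * k.+1 = j.+1)%N by lia.
have -> : ((2 * k + j).+2 - 2 * k.+1 = j)%N by lia.
have -> : ((2 * k + j).+1 - 2 * k = j.+1)%N by lia.
rewrite /= !factS !natrM.
have := fact_neq0 k; have := fact_neq0 j.
move: (k`!%:R) (j`!%:R) ((k + j)`!%:R) => K J L J0 K0.
have k1 : k.+1%:R != 0 :> rat by rewrite pnatr_eq0.
have j1 : j.+1%:R != 0 :> rat by rewrite pnatr_eq0.
rewrite -!natr1 ?natrD ?natrM in k1 j1 *.
by field; rewrite J0 K0 k1 j1.
Qed.

(** Entries outside the triangle are 0; this lets sums for different [m] share one range. *)
Lemma SUM_widen (r s : int) m N : (m./2 < N)%N ->
  SUM r s m = r%:~R ^+ m *
    \sum_(0 <= k < N) lucasT m k * (s%:~R / r%:~R ^+ 2) ^+ k.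
Proof.
move=> ltmN; rewrite /SUM (big_cat_nat (leq0n _) ltmN) /=.
rewrite [X in _ = _ * (_ + X)]big_nat_cond [X in _ = _ * (_ + X)]big1 ?addr0 //.
move=> k /andP[/andP[ltmk _] _].
by rewrite /lucasT leqNgt ltmk mul0r.
Qed.

Lemma SUM0 (r s : int) : SUM r s 0 = 2.
Proof. by rewrite /SUM big_nat1 expr0 mul1r mulr1. Qed.

Lemma SUM1 (r s : int) : SUM r s 1 = r%:~R.
Proof. by rewrite /SUM big_nat1 lucasT0 !mulr1. Qed.

Lemma SUM_rec (r s : int) m : r != 0 ->
  SUM r s m.+2 = r%:~R * SUM r s m.+1 + s%:~R * SUM r s m.
Proof.
move=> r0; have rQ0 : r%:~R != 0 :> rat by rewrite intr_eq0.
(* Once the [k = 0] terms of the first two sums are split off, all three sums run over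
   [k < m.+1]. *)
rewrite (@SUM_widen _ _ m.+2 m.+2) 1?(@SUM_widen _ _ m.+1 m.+2); [|by lia..].
rewrite (@SUM_widen _ _ m m.+1); last by lia.
rewrite !(big_nat_recl m.+1) //= !lucasT0.
under eq_bigr do rewrite lucasT_rec mulrDl.
rewrite big_split /=.
(* The index shift leaves one factor s/r^2, and r^(m+2) * (s/r^2) = s * r^m. *)
under [X in _ * (_ + (_ + X))]eq_bigr do rewrite exprS mulrCA.
rewrite -mulr_sumr !exprS; move: (\sum_(_ <= _ < _) _) (\sum_(_ <= _ < _) _) => A B.
by field; rewrite rQ0.
Qed.

Lemma horadam_step (p q r s : int) m n : r != 0 ->
  (horadam p q r s (n + m + m))%:~R =
    SUM r s m * (horadam p q r s (n + m))%:~R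
    - (- s%:~R) ^+ m * (horadam p q r s n)%:~R :> rat.
Proof.
move=> r0; set H : nat -> rat := fun n => (horadam p q r s n)%:~R.
have HS i : H i.+2 = r%:~R * H i.+1 + s%:~R * H i by rewrite /H /= intrD !intrM.
rewrite -!/(H _).
(* Two consecutive values of [m] are carried along, for all [n], since the induction step shifts
   [n]. *)
suff: forall n, (H (n + m + m)%N = SUM r s m * H (n + m)%N - (- s%:~R) ^+ m * H n)
  /\ (H (n + m.+1 + m.+1)%N =
      SUM r s m.+1 * H (n + m.+1)%N - (- s%:~R) ^+ m.+1 * H n).
  by case/(_ n).
elim: m {n} => [|m IH] n.
  by rewrite SUM0 SUM1 !addn0 !addn1 HS; split; ring.
split; first by case: (IH n).
(* Both instances involve the same middle term H(n+m+2). The remaining terms combine through r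
   H(n+1) - H(n+2) = -s H(n). *)
have [_ IH1] := IH n.+1; have [IH0 _] := IH n.+2.
move: IH1 IH0; rewrite SUM_rec // !addSn !addnS !addSn => IH1 IH0.
rewrite (HS (n + m + m).+2) IH1 IH0 (HS n) !exprS; ring.
Qed.

Theorem mainTheorem3 (p q r s : int) (m l : nat)
    (hr : r != 0) (hs : s != 0) (hm : (1 <= m)%N) (hl : (l < m)%N) :
  let H n : rat := (horadam p q r s n)%:~R in
  GHml p q r s m l =
    (fpsC (H l) - fpsC (H l * SUM r s m - H (m + l)%N) * fpsX)
    / (1 - fpsC (SUM r s m) * fpsX + fpsC ((- s%:~R) ^+ m) * fpsX ^+ 2).
Proof.
move=> H; apply: fps_eq_div => [||n] /=.
- by rewrite muln0.
- by rewrite muln1 /H; ring.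
(* Consecutive coefficients are terms of H spaced [m] apart, starting from index [m * n + l]. *)
have -> : (m * n.+2 + l = m * n + l + m + m)%N by lia.
have -> : (m * n.+1 + l = m * n + l + m)%N by lia.
exact: horadam_step.
Qed.
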